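(* For any integer $n \geq 0$ and any $t \geq 0$, $$\lim_{k \rightarrow \infty} \tau\left(\frac{(W_t^k)^n}{k^{2n}}\right) = [\tau(U_t)]^{2n} = e^{-nt},$$ where $W_t^k = G_t^k(G_t^k)^{\star}$ and $G_t^k = U_t^1+\dots+U_t^k$. In particular, for every $t \ge 0$, the free Jacobi process $PU_tPU_t^{\star}P$ with $\tau(P) = 1/k$, viewed in the compressed algebra $(P\mathscr{A}P,k\tau)$, converges weakly as $k \rightarrow \infty$ to the constant $e^{-t}$ (i.e. its spectral distribution converges weakly to the Dirac mass at $e^{-t}$).
   Context: $(\mathscr{A},\tau)$ is a tracial non commutative probability space (a von Neumann algebra with faithful normal tracial state $\tau$). $(U_t)_{t\ge 0}$ is a free unitary Brownian motion in $\mathscr{A}$, i.e. the solution of the free stochastic differential equation $dU_t = iU_t\,dX_t - \frac{1}{2}U_t\,dt$, $U_0 = {\bf 1}$, where $(X_t)_{t \ge 0}$ is a free additive Brownian motion. For each integer $k\ge2$, $(U_t^j)_{t\ge0}$, $1\le j\le k$, are $k$ $\star$-free copies of $(U_t)_{t \ge 0}$ in $(\mathscr{A},\tau)$, and $P=P_k\in\mathscr{A}$ is a self-adjoint projection with $\tau(P)=1/k$ which is free from $\{U_t,U_t^{\star}\}_{t\ge0}$. The compressed space $P\mathscr{A}P$ has unit $P$ and tracial state $k\tau$. *)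

(* Defs.v *)
From HB Require Import structures.
From mathcomp Require Import all_boot all_order all_algebra.
From mathcomp Require Import complex.
From mathcomp Require Import all_classical all_reals all_analysis.
Set Implicit Arguments.
Unset Strict Implicit.
Unset Printing Implicit Defensive.
Import Order.TTheory GRing.Theory Num.Theory numFieldNormedType.Exports.
Local Open Scope classical_set_scope.
Local Open Scope complex_scope.
Local Open Scope ring_scope.

Section Operators.
Context {R : realType} {H : completeNormedModType R[i]}.

Definition bounded_operator (T : H -> H) : Prop :=
  linear T /\ exists C : R, forall x, `|T x| <= C%:C * `|x|.

Definition commutant (S : set (H -> H)) : set (H -> H) :=
  [set T | bounded_operator T /\ forall T', S T' -> T \o T' = T' \o T].

(* Linear in the first argument; the norm of H is the one of the inner
   product, so that H is a complex Hilbert space. *)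
Definition inner_product (dot : H -> H -> R[i]) : Prop :=
  [/\ forall (c : R[i]) x y z, dot (c *: x + y) z = c * dot x z + dot y z,
      forall x y, dot y x = (dot x y)^* &
      forall x, dot x x = `|x| ^+ 2].

End Operators.

(* A concrete von Neumann algebra: a unital *-algebra of bounded operators on a
   Hilbert space, equal to its bicommutant.  The operators are the vn_act a, and
   vn_act is injective, so that the algebra laws live on an algType. *)
Record von_neumann_algebra (R : realType) := VonNeumannAlgebra {
  vn_alg :> algType R[i];
  vn_space : completeNormedModType R[i];
  vn_dot : vn_space -> vn_space -> R[i];
  vn_act : vn_alg -> vn_space -> vn_space;
  star : vn_alg -> vn_alg;
  vn_dotP : inner_product vn_dot;
  vn_act_bounded : forall a, bounded_operator (vn_act a);
  vn_act_inj : injective vn_act;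
  vn_act1 : forall x, vn_act 1 x = x;
  vn_actM : forall a b x, vn_act (a * b) x = vn_act a (vn_act b x);
  vn_act_linear : forall (c : R[i]) a b x,
    vn_act (c *: a + b) x = c *: vn_act a x + vn_act b x;
  vn_act_star : forall a x y,
    vn_dot (vn_act a x) y = vn_dot x (vn_act (star a) y);
  vn_bicommutant : commutant (commutant (range vn_act)) = range vn_act
}.

Section VonNeumann.
Context {R : realType} {M : von_neumann_algebra R}.
Implicit Types (a b p u : M) (B S : set M).

Definition selfadjoint a : Prop := star a = a.
Definition positive a : Prop := exists b, a = star b * b.
Definition unitary u : Prop := star u * u = 1 /\ u * star u = 1.
Definition projection p : Prop := selfadjoint p /\ p * p = p.

Definition star_subalgebra B : Prop :=
  [/\ B 1,
      forall (c : R[i]) a b, B a -> B b -> B (c *: a + b),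
      forall a b, B a -> B b -> B (a * b) &
      forall a, B a -> B (star a)].

Definition star_algebra_gen S : set M := smallest star_subalgebra S.

Definition von_neumann_subalgebra B : Prop :=
  star_subalgebra B /\
  commutant (commutant ((@vn_act R M) @` B)) = (@vn_act R M) @` B.

Definition is_lub (D : set M) (s : M) : Prop :=
  (forall d, D d -> positive (s - d)) /\
  (forall s', (forall d, D d -> positive (s' - d)) -> positive (s' - s)).

(* tau preserves suprema of increasing nets of self-adjoint elements (that
   tau s is an upper bound follows from the positivity of tau). *)
Definition normal (tau : M -> R[i]) : Prop :=
  forall (D : set M) (s : M),
    D !=set0 -> (forall d, D d -> selfadjoint d) ->
    (forall d1 d2, D d1 -> D d2 ->
       exists d, [/\ D d, positive (d - d1) & positive (d - d2)]) ->
    is_lub D s ->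
    forall c : R, (forall d, D d -> tau d <= c%:C) -> tau s <= c%:C.

Record faithful_normal_tracial_state (tau : {scalar M}) : Prop := {
  tau1 : tau 1 = 1;
  tau_ge0 : forall a, 0 <= tau (star a * a);
  tau_trace : forall a b, tau (a * b) = tau (b * a);
  tau_faithful : forall a, tau (star a * a) = 0 -> a = 0;
  tau_normal : normal tau
}.

Section Probability.
Variable tau : {scalar M}.

Definition free_family (I : Type) (B : I -> set M) : Prop :=
  forall (m : nat) (i : nat -> I) (a : nat -> M),
    (forall j, (j <= m)%N -> B (i j) (a j) /\ tau (a j) = 0) ->
    (forall j, (j < m)%N -> i j <> i j.+1) ->
    tau (\prod_(j < m.+1) a j) = 0.

Definition free_pair (B1 B2 : set M) : Prop :=
  free_family (fun b : bool => if b then B1 else B2).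

(* A process is a map on R of which only the values at times t >= 0 matter. *)
Definition process_range (Y : R -> M) : set M := Y @` [set t | 0 <= t].

Definition same_star_distribution (Y Z : R -> M) : Prop :=
  forall w : seq (R * bool),
    (forall x, x \in w -> 0 <= x.1) ->
    tau (\prod_(x <- w) (if x.2 then star (Y x.1) else Y x.1)) =
    tau (\prod_(x <- w) (if x.2 then star (Z x.1) else Z x.1)).

(* The semicircle law of mean 0 and variance v lives on [-2 sqrt v, 2 sqrt v],
   with density sqrt (4 v - y^2) / (2 pi v). *)
Definition semicircular (v : R) (x : M) : Prop :=
  selfadjoint x /\
  forall n : nat, tau (x ^+ n) =
    (\int[lebesgue_measure]_(y in `[(- (2 * Num.sqrt v)), (2 * Num.sqrt v)])
       (y ^+ n * (Num.sqrt (4 * v - y ^+ 2) / (2 * pi * v))))%:C.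

Definition filtration (F : R -> set M) : Prop :=
  (forall t, 0 <= t -> von_neumann_subalgebra (F t)) /\
  (forall s t, 0 <= s -> s <= t -> F s `<=` F t).

Definition free_additive_BM (F : R -> set M) (X : R -> M) : Prop :=
  [/\ X 0 = 0,
      forall t, 0 <= t -> F t (X t) /\ selfadjoint (X t) &
      forall s t, 0 <= s -> s < t ->
        semicircular (t - s) (X t - X s) /\
        free_pair (F s) (star_algebra_gen [set X t - X s])].

Definition norm2 a : R := Num.sqrt (complex.Re (tau (star a * a))).

(* The step process \sum_(i < m) y i * 1_[p i, p i.+1). *)
Record step_process := StepProcess {
  step_size : nat;
  step_time : nat -> R;
  step_val : nat -> M
}.

Definition step_on (t : R) (Y : step_process) : Prop :=
  [/\ step_time Y 0 = 0, step_time Y (step_size Y) = t &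
      forall i, (i < step_size Y)%N -> step_time Y i <= step_time Y i.+1].

Definition step_adapted (F : R -> set M) (Y : step_process) : Prop :=
  forall i, (i < step_size Y)%N -> F (step_time Y i) (step_val Y i).

Definition step_eval (Y : step_process) (s : R) : M :=
  \sum_(i < step_size Y)
    (if step_time Y i <= s < step_time Y i.+1 then step_val Y i else 0).

Definition step_ito (X : R -> M) (Y : step_process) : M :=
  \sum_(i < step_size Y)
    step_val Y i * (X (step_time Y i.+1) - X (step_time Y i)).

Definition step_integral (Y : step_process) : M :=
  \sum_(i < step_size Y)
    (step_time Y i.+1 - step_time Y i)%:C *: step_val Y i.

(* J is the value at t of the L^2(tau)-extension, by the Ito isometry, of the
   free stochastic integral of adapted step processes. *)
Definition is_ito_integral (F : R -> set M) (X Y : R -> M) (t : R) (J : M)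
    : Prop :=
  exists Yn : nat -> step_process,
    [/\ forall n, step_on t (Yn n) /\ step_adapted F (Yn n),
        (\int[lebesgue_measure]_(s in `[0%R, t])
            ((norm2 (Y s - step_eval (Yn n) s) ^+ 2)%:E))%E
          @[n --> \oo] --> 0%E &
        norm2 (J - step_ito X (Yn n)) @[n --> \oo] --> (0 : R)].

(* D is the Bochner integral of Y over [0, t] in L^2(tau). *)
Definition is_time_integral (Y : R -> M) (t : R) (D : M) : Prop :=
  exists Yn : nat -> step_process,
    [/\ forall n, step_on t (Yn n),
        (\int[lebesgue_measure]_(s in `[0%R, t])
            ((norm2 (Y s - step_eval (Yn n) s))%:E))%E
          @[n --> \oo] --> 0%E &
        norm2 (D - step_integral (Yn n)) @[n --> \oo] --> (0 : R)].

Definition L2_continuous (Y : R -> M) : Prop :=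
  forall t, 0 <= t ->
    norm2 (Y s - Y t) @[s --> within [set s | 0 <= s] (nbhs t)] --> (0 : R).

(* dU = i U dX - U/2 dt, U_0 = 1, in integral form; a solution is an adapted
   L^2-continuous process of unitaries. *)
Definition free_unitary_SDE (F : R -> set M) (X U : R -> M) : Prop :=
  [/\ U 0 = 1,
      forall t, 0 <= t -> F t (U t) /\ unitary (U t),
      L2_continuous U &
      forall t, 0 <= t -> exists J D : M,
        [/\ is_ito_integral F X U t J, is_time_integral U t D &
            U t = 1 + 'i%C *: J - (2^-1 : R[i]) *: D]].

Definition free_unitary_BM (U : R -> M) : Prop :=
  exists F X, [/\ filtration F, free_additive_BM F X & free_unitary_SDE F X U].

Definition star_free_copies (U : R -> M) (k : nat) (V : 'I_k -> R -> M) : Prop :=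
  (forall j, same_star_distribution (V j) U) /\
  free_family (fun j => star_algebra_gen (process_range (V j))).

Definition compressing_projection (U : R -> M) (k : nat) (P : M) : Prop :=
  [/\ projection P, tau P = k%:R^-1 &
      free_pair (star_algebra_gen [set P])
                (star_algebra_gen (process_range U))].

(* n-th moment, in the algebra P M P with unit P and state tau / tau(P), of an
   element a of P M P; the leading P gives a ^+ 0 the value P. *)
Definition compressed_moment (P a : M) (n : nat) : R[i] :=
  (tau P)^-1 * tau (P * a ^+ n).

(* mu is the compactly supported law whose moments are those of a. *)
Definition compressed_spectral_distribution (P a : M)
    (mu : probability (measurableTypeR R) R) : Prop :=
  (exists C : R, mu `[- C, C]%classic = 1%E) /\
  (forall n, compressed_moment P a n = (\int[mu]_x (x ^+ n))%:C).

End Probability.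

Definition free_jacobi (P : M) (U : R -> M) (t : R) : M :=
  P * U t * P * star (U t) * P.

End VonNeumann.

Definition weakly_converges (R : realType)
    (mu : nat -> probability (measurableTypeR R) R)
    (nu : probability (measurableTypeR R) R) : Prop :=
  forall f : R -> R, continuous f -> (exists C : R, forall x, `|f x| <= C) ->
    (\int[mu k]_x f x) @[k --> \oo] --> (\int[nu]_x f x : R).

(* Main.v *)
(* The algebra is used through the seminorm |a|_2 = tau(a^* a)^(1/2). A convex
   combination of unitaries, or a compression of one by a projection, acts as a
   contraction B for this seminorm, so |p (B B^* )^n - c^(2n) p|_2 is at most
   2n |B - c p|_2 by telescoping: no words in free variables are expanded. Both
   parts of the statement reduce to a variance bound for B with c = tau(U_t):
   freeness gives |G_t^k / k - c|_2 <= k^(-1/2) for p = 1, and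
   |P U_t P - c P|_2 <= k^-1 for p = P, where |P|_2 = k^(-1/2); after dividing
   by tau(p) the error is 2n / sqrt k in each case.
   Freeness of the increments kills the trace of the stochastic integral, hence
   tau(U_t) = 1 - 1/2 int_0^t tau(U_s) ds and c = e^(-t/2). Weak convergence to
   the Dirac mass only needs the first two moments. *)
Require Import Defs.
From HB Require Import structures.
From mathcomp Require Import all_boot all_order all_algebra.
From mathcomp Require Import complex.
From mathcomp Require Import all_classical all_reals all_analysis.
From mathcomp Require Import measurable_realfun ring lra.
Set Implicit Arguments.
Unset Strict Implicit.
Unset Printing Implicit Defensive.
Import Order.TTheory GRing.Theory Num.Theory numFieldNormedType.Exports.
Local Open Scope classical_set_scope.
Local Open Scope complex_scope.
Local Open Scope ring_scope.

(** * Star operation and trace seminorm *)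

Section Star.
Context {R : realType} {M : von_neumann_algebra R}.
Implicit Types a b : M.
Implicit Types x y z : vn_space M.
Local Notation dot := (@vn_dot R M).

Lemma vn_dotDl x y z : dot (x + y) z = dot x z + dot y z.
Proof.
have [H _ _] := vn_dotP M.
by have := H 1 x y z; rewrite scale1r mul1r.
Qed.

Lemma vn_dot0l z : dot 0 z = 0.
Proof. by apply: (addrI (dot 0 z)); rewrite -vn_dotDl !addr0. Qed.

Lemma vn_dotZl (c : R[i]) x z : dot (c *: x) z = c * dot x z.
Proof.
have [H _ _] := vn_dotP M.
by have := H c x 0 z; rewrite addr0 vn_dot0l addr0.
Qed.

Lemma vn_dotC x y : dot y x = (dot x y)^*%C.
Proof. by have [_ H _] := vn_dotP M; rewrite H. Qed.

Lemma vn_dotDr x y z : dot x (y + z) = dot x y + dot x z.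
Proof. by rewrite vn_dotC vn_dotDl rmorphD /= -!vn_dotC. Qed.

Lemma vn_dotZr (c : R[i]) x z : dot x (c *: z) = c^*%C * dot x z.
Proof. by rewrite vn_dotC vn_dotZl rmorphM /= -vn_dotC. Qed.

Lemma vn_dot_injr y z : (forall x, dot x y = dot x z) -> y = z.
Proof.
move=> H; apply/eqP; rewrite -subr_eq0 -normr_eq0 -sqrf_eq0.
have [_ _ <-] := vn_dotP M.
by rewrite vn_dotDr H -scaleN1r vn_dotZr rmorphN1 mulN1r subrr.
Qed.

Lemma vn_actD a b x : vn_act (a + b) x = vn_act a x + vn_act b x.
Proof. by have := vn_act_linear 1 a b x; rewrite !scale1r. Qed.

Lemma vn_act0 x : vn_act (0 : M) x = 0.
Proof. by apply: (addrI (vn_act (0 : M) x)); rewrite -vn_actD !addr0. Qed.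

Lemma vn_actZ (c : R[i]) a x : vn_act (c *: a) x = c *: vn_act a x.
Proof. by have := vn_act_linear c a 0 x; rewrite addr0 vn_act0 addr0. Qed.

(** The record gives [star] only as an adjoint. Nondegeneracy of the inner product and injectivity
    of [vn_act] make adjoints unique, and the algebraic laws of the involution are derived from
    that. *)
Lemma star_unique a b :
  (forall x y, dot (vn_act a x) y = dot x (vn_act b y)) -> star a = b.
Proof.
move=> H; apply: vn_act_inj; apply/funext => y.
by apply: vn_dot_injr => x; rewrite -vn_act_star.
Qed.

Lemma starK a : star (star a) = a.
Proof.
by apply: star_unique => x y; rewrite vn_dotC -vn_act_star -vn_dotC.
Qed.

Lemma starD a b : star (a + b) = star a + star b.
Proof.
by apply: star_unique => x y; rewrite !vn_actD vn_dotDl vn_dotDr !vn_act_star.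
Qed.

Lemma starZ (c : R[i]) a : star (c *: a) = c^*%C *: star a.
Proof.
apply: star_unique => x y.
by rewrite !vn_actZ vn_dotZl vn_dotZr vn_act_star conjcK.
Qed.

Lemma starM a b : star (a * b) = star b * star a.
Proof. by apply: star_unique => x y; rewrite !vn_actM !vn_act_star. Qed.

Lemma star1 : star 1 = 1 :> M.
Proof. by apply: star_unique => x y; rewrite !vn_act1. Qed.

Lemma starN a : star (- a) = - star a.
Proof. by rewrite -scaleN1r starZ rmorphN1 scaleN1r. Qed.

Lemma starB a b : star (a - b) = star a - star b.
Proof. by rewrite starD starN. Qed.

Lemma star0 : star 0 = 0 :> M.
Proof. by apply: (addrI (star 0)); rewrite -starD !addr0. Qed.

Lemma star_sum (I : Type) (r : seq I) (Q : pred I) (F : I -> M) :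
  star (\sum_(i <- r | Q i) F i) = \sum_(i <- r | Q i) star (F i).
Proof. exact: (big_morph _ starD star0). Qed.

End Star.

Section L2.
Context {R : realType} {M : von_neumann_algebra R} (tau : {scalar M}).
Hypothesis Htau : faithful_normal_tracial_state tau.
Implicit Types a b c p u : M.
Local Notation "N2[ a ]" := (norm2 tau a) (format "N2[ a ]").

Lemma tauZ z a : tau (z *: a) = z * tau a.
Proof. by rewrite linearZ. Qed.

Lemma tau_scalar (c : R[i]) : tau (c *: 1) = c.
Proof. by rewrite linearZ /= (tau1 Htau) mulr1. Qed.

(** Polarization: [tau] is real on [star b * b]. For [b = 1 + a] the imaginary parts of [tau a] and
    [tau (star a)] cancel; for [b = 1 + 'i%C *: a] their real parts agree. *)
Lemma tau_star a : tau (star a) = (tau a)^*%C.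
Proof.
have P1 := tau_ge0 Htau (1 + a); have P2 := tau_ge0 Htau (1 + 'i%C *: a).
have P3 := tau_ge0 Htau a.
move: P1 P2; rewrite !starD starZ star1 !mulrDl !mulrDr !mul1r !mulr1.
rewrite -!scalerAr -!scalerAl scalerA !linearD /= !linearZ /= (tau1 Htau).
move: P3; rewrite !lecE /=.
case: (tau (star a * a)) => r i; case: (tau a) => x y; case: (tau (star a)) => z w.
simpc => /= /andP[/eqP -> _] /andP[/eqP h1 _] /andP[/eqP h2 _].
by apply/eqP; rewrite eq_complex /=; apply/andP; split; apply/eqP; lra.
Qed.

Lemma norm2_ge0 a : 0 <= N2[a].
Proof. exact: sqrtr_ge0. Qed.

Lemma sqr_norm2 a : (N2[a] ^+ 2)%:C = tau (star a * a).
Proof.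
have := tau_ge0 Htau a; rewrite /norm2 lecE /= => /andP[/eqP i0 r0].
by rewrite sqr_sqrtr//; apply/eqP; rewrite eq_complex /= i0 !eqxx.
Qed.

Lemma norm2_le a (r : R) : 0 <= r -> tau (star a * a) <= (r ^+ 2)%:C -> N2[a] <= r.
Proof.
move=> r0; rewrite -sqr_norm2 lecR.
by rewrite ler_pXn2r// nnegrE norm2_ge0.
Qed.

Lemma norm2_eq a b : tau (star a * a) = tau (star b * b) -> N2[a] = N2[b].
Proof. by rewrite /norm2 => ->. Qed.

Lemma norm2_star a : N2[star a] = N2[a].
Proof. by apply: norm2_eq; rewrite starK (tau_trace Htau). Qed.

Lemma norm2_eq0 a : N2[a] = 0 -> a = 0.
Proof.
by move=> a0; apply: (tau_faithful Htau); rewrite -sqr_norm2 a0 expr0n.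
Qed.

Lemma norm20 : N2[0] = 0.
Proof. by rewrite /norm2 mulr0 linear0 sqrtr0. Qed.

Lemma norm21 : N2[1] = 1.
Proof. by rewrite /norm2 star1 mulr1 (tau1 Htau) sqrtr1. Qed.

Lemma norm2Z (z : R[i]) a : (N2[z *: a])%:C = `|z| * (N2[a])%:C.
Proof.
have n0 : 0 <= `|z| * (N2[a])%:C by rewrite mulr_ge0// ler0c norm2_ge0.
apply/eqP; rewrite -(@eqrXn2 _ 2) ?ler0c ?norm2_ge0// exprMn sqr_normc -!rmorphXn /=.
rewrite !sqr_norm2 starZ -scalerAr -scalerAl scalerA linearZ /=.
by [].
Qed.

Lemma norm2Zr (r : R) a : N2[r%:C *: a] = `|r| * N2[a].
Proof.
apply: complexI; rewrite norm2Z rmorphM /=; congr (_ * _).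
by rewrite normc_def /= expr0n addr0 sqrtr_sqr.
Qed.

Lemma cauchy_schwarz a b : `|tau (star a * b)| <= (N2[a] * N2[b])%:C.
Proof.
have [/norm2_eq0 ->|b0] := eqVneq (N2[b]) 0.
  by rewrite mulr0 linear0 normr0 ler0c mulr_ge0 ?norm2_ge0.
have bp : 0 < N2[b] by rewrite lt_def b0 norm2_ge0.
rewrite -(@ler_pXn2r _ 2)// ?nnegrE ?ler0c ?mulr_ge0 ?norm2_ge0//.
rewrite sqr_normc -tau_star starM starK.
set s := tau (star b * a); set s' := tau (star a * b).
have E : s'^*%C = s by rewrite /s' -tau_star starM starK.
(* The argument is |b|^2 times the component of [a] orthogonal to [b]; its squared seminorm is |b|^2
   (|a|^2 |b|^2 - |s|^2). *)
have := tau_ge0 Htau ((N2[b] ^+ 2)%:C *: a - s *: b).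
rewrite starB !starZ mulrBl !mulrBr -!scalerAl -!scalerAr !scalerA.
have CR (r : R) : (r%:C)^*%C = r%:C by rewrite conjc_real.
rewrite !CR !raddfB /= !tauZ -!sqr_norm2 -/s -/s' -E conjcK.
set A := N2[a]; set B := N2[b].
have -> : (B ^+ 2)%:C * (B ^+ 2)%:C * (A ^+ 2)%:C - (B ^+ 2)%:C * s'^*%C * s' +
  (- (s' * (B ^+ 2)%:C * s'^*%C) - - (s' * s'^*%C * (B ^+ 2)%:C)) =
  (B ^+ 2)%:C * (((A * B) ^+ 2)%:C - s' * s'^*%C).
  by rewrite exprMn !rmorphM /=; ring.
have B2 : 0 < (B ^+ 2)%:C by rewrite ltcE /= eqxx exprn_gt0.
by rewrite pmulr_rge0 // subr_ge0 rmorphXn.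
Qed.

Lemma norm_tau_le a : `|tau a| <= (N2[a])%:C.
Proof. by have := cauchy_schwarz 1 a; rewrite star1 !mul1r norm21 mul1r. Qed.

Lemma norm2D a b : N2[a + b] <= N2[a] + N2[b].
Proof.
apply: norm2_le; first by rewrite addr_ge0 ?norm2_ge0.
rewrite starD mulrDl !mulrDr !linearD /= -!sqr_norm2.
have H x y : tau (star x * y) + tau (star y * x) <= (2 * (N2[x] * N2[y]))%:C.
  have -> : star y * x = star (star x * y) by rewrite starM starK.
  rewrite tau_star addcJ -[2%:R](rmorph_nat (real_complex R)) -rmorphM /= lecR.
  rewrite ler_pM2l// -lecR; apply: le_trans (cauchy_schwarz x y).
  by apply: le_trans (normc_ge_Re _); rewrite lecR ler_norm.
have -> : (N2[a] + N2[b]) ^+ 2 = N2[a] ^+ 2 + 2 * (N2[a] * N2[b]) + N2[b] ^+ 2.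
  by ring.
by rewrite !rmorphD /= -!addrA lerD2l !addrA lerD2r H.
Qed.

End L2.

(** * Contractions and freeness *)

Section Contraction.
Context {R : realType} {M : von_neumann_algebra R} (tau : {scalar M}).
Hypothesis Htau : faithful_normal_tracial_state tau.
Implicit Types a b c p u : M.
Local Notation "N2[ a ]" := (norm2 tau a) (format "N2[ a ]").

Lemma norm2_sum_le (I : Type) (r : seq I) (F : I -> M) :
  N2[\sum_(i <- r) F i] <= \sum_(i <- r) N2[F i].
Proof.
elim: r => [|i r IH]; first by rewrite !big_nil norm20.
by rewrite !big_cons (le_trans (norm2D Htau _ _))// lerD2l.
Qed.

(** Stands in for operator norm at most 1, so that all estimates stay within the trace seminorm. *)
Definition L2contraction a : Prop := forall b, N2[a * b] <= N2[b].

(** Duality: the square of |star a b| pairs [b] with [a * (star a * b)], so Cauchy-Schwarz and the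
    hypothesis bound it by |b| |star a b|; then one factor is divided out. *)
Lemma L2contraction_star a : L2contraction a -> L2contraction (star a).
Proof.
move=> ca b; have [->|ab0] := eqVneq N2[star a * b] 0; first exact: norm2_ge0.
have abp : 0 < N2[star a * b] by rewrite lt_def ab0 norm2_ge0.
rewrite -(ler_pM2r abp).
apply: (@le_trans _ _ (N2[b] * N2[a * (star a * b)])); last first.
  by rewrite ler_wpM2l ?norm2_ge0.
rewrite -lecR -expr2 -[leLHS]ger0_norm ?ler0c ?sqr_ge0// sqr_norm2// starM starK -mulrA.
exact: cauchy_schwarz.
Qed.

Lemma L2contractionM a b : L2contraction a -> L2contraction b -> L2contraction (a * b).
Proof. by move=> ca cb c; rewrite -mulrA (le_trans (ca _)). Qed.

Lemma L2contraction_isometry u : star u * u = 1 -> L2contraction u.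
Proof.
move=> uu b; rewrite (_ : N2[u * b] = N2[b])//; apply: norm2_eq.
by rewrite starM -mulrA (mulrA (star u)) uu mul1r.
Qed.

Lemma L2contraction_projection p : projection p -> L2contraction p.
Proof.
move=> [sp pp] b; have [->|pb0] := eqVneq N2[p * b] 0; first exact: norm2_ge0.
have pbp : 0 < N2[p * b] by rewrite lt_def pb0 norm2_ge0.
rewrite -(ler_pM2r pbp) -lecR -expr2 -[leLHS]ger0_norm ?ler0c ?sqr_ge0//.
rewrite sqr_norm2// starM sp -mulrA (mulrA p) pp.
exact: cauchy_schwarz.
Qed.

Lemma L2contraction_mean k (F : 'I_k -> M) : (forall j, L2contraction (F j)) ->
  L2contraction ((k%:R^-1)%:C *: \sum_j F j).
Proof.
move=> cF b; rewrite -scalerAl norm2Zr// ger0_norm// mulr_suml.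
case: k F cF => [|k] F cF; first by rewrite big_ord0 norm20 mulr0 norm2_ge0.
rewrite ler_pdivrMl ?ltr0n//; apply: le_trans (norm2_sum_le _ _) _.
apply: (@le_trans _ _ (\sum_(j < k.+1) N2[b])).
  by apply: ler_sum => j _; exact: cF.
by rewrite sumr_const card_ord mulr_natl.
Qed.

Section Powers.
Variables (p B : M) (c : R).
Hypotheses (pp : projection p) (cB : L2contraction B).
Hypotheses (pB : p * B = B) (Bp : B * p = B) (c0 : 0 <= c) (c1 : c <= 1).
Let T := B * star B.
Let cp := (c%:C) *: p.

(** Each further power of [T] adds at most one error |T - c^2 p|, since [T] is a contraction and
    [c <= 1]. The leading [p] makes the power 0 equal to the unit of the corner algebra. *)
Lemma norm2_powers_sub n :
  N2[p * T ^+ n - (c ^+ (2 * n))%:C *: p] <= (2 * n)%:R * N2[B - cp].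
Proof.
have [sp _] := pp.
have sB : star B * p = star B by rewrite -{2}pB starM sp.
have Tp : T * p = T by rewrite /T -mulrA sB.
have pT : p * T = T by rewrite /T mulrA pB.
have cT : L2contraction T by apply: L2contractionM => //; exact: L2contraction_star.
(* The difference splits as [B * star (B - cp)] plus [c] times [B - cp]. Each summand costs |B -
   cp|, the first because the seminorm is invariant under [star]. *)
have T1 : N2[T - (c ^+ 2)%:C *: p] <= 2 * N2[B - cp].
  have -> : T - (c ^+ 2)%:C *: p = B * star (B - cp) + c%:C *: (B - cp).
    rewrite starB starZ sp conjc_real mulrBr -scalerAr Bp scalerBr scalerA.
    by rewrite -rmorphM /= -expr2 addrA subrK.
  apply: le_trans (norm2D Htau _ _) _; rewrite mulr_natl mulr2n lerD//.
    by rewrite (le_trans (cB _))// norm2_star.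
  by rewrite norm2Zr// ger0_norm// ler_piMl// norm2_ge0.
elim: n => [|n IH].
  by rewrite muln0 !expr0 mulr1 scale1r subrr norm20 mul0r.
have -> : p * T ^+ n.+1 - (c ^+ (2 * n.+1))%:C *: p =
  T * (p * T ^+ n - (c ^+ (2 * n))%:C *: p) +
  (c ^+ (2 * n))%:C *: (T - (c ^+ 2)%:C *: p).
  rewrite mulrBr -scalerAr mulrA Tp exprS mulrA pT scalerBr scalerA -rmorphM /=.
  by rewrite -exprD addrA subrK mulnS addnC.
apply: le_trans (norm2D Htau _ _) _.
rewrite mulnS addnC natrD mulrDl lerD//; first exact: le_trans (cT _) IH.
rewrite norm2Zr// ger0_norm ?exprn_ge0//; apply: le_trans T1.
by rewrite ler_piMl ?norm2_ge0// exprn_ile1.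
Qed.

(** Cauchy-Schwarz against [p] keeps the factor |p|; without it the bound would not tend to 0 once
    divided by [tau p = 1/k]. *)
Lemma tau_powers_sub n :
  `|tau (p * T ^+ n) - (c ^+ (2 * n))%:C * tau p| <=
  (N2[p] * ((2 * n)%:R * N2[B - cp]))%:C.
Proof.
have [sp p2] := pp.
have -> : tau (p * T ^+ n) - (c ^+ (2 * n))%:C * tau p =
    tau (star p * (p * T ^+ n - (c ^+ (2 * n))%:C *: p)).
  by rewrite sp mulrBr mulrA -scalerAr p2 raddfB /= tauZ.
apply: le_trans (cauchy_schwarz Htau _ _) _.
by rewrite lecR ler_wpM2l ?norm2_ge0// norm2_powers_sub.
Qed.

End Powers.

(** Centring projects orthogonally off the scalars: |a - tau a|^2 = |a|^2 - |tau a|^2. *)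
Lemma norm2_center a : N2[a - tau a *: 1] <= N2[a].
Proof.
apply: norm2_le => //; first exact: norm2_ge0.
rewrite sqr_norm2// starB starZ star1 mulrBl !mulrBr -!scalerAr -!scalerAl.
rewrite !mulr1 !mul1r !raddfB /= !tauZ (tau1 Htau) tau_star//.
rewrite mulr1 (mulrC (tau a)) opprK addNr addr0 gerBl.
by rewrite mulrC mulcJ_ge0.
Qed.

Lemma tau_center a : tau (a - tau a *: 1) = 0.
Proof. by rewrite raddfB /= tau_scalar// subrr. Qed.

Lemma sqr_norm2_sum_orthogonal k (v : 'I_k -> M) :
  (forall i j, i != j -> tau (star (v i) * v j) = 0) ->
  N2[\sum_j v j] ^+ 2 = \sum_j N2[v j] ^+ 2.
Proof.
move=> orth; apply: complexI; rewrite sqr_norm2// star_sum mulr_suml !raddf_sum /=.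
apply: eq_bigr => i _; rewrite mulr_sumr raddf_sum (bigD1 i)//= big1 ?addr0 ?sqr_norm2//.
by move=> j ji; rewrite orth// eq_sym.
Qed.

End Contraction.

Section Freeness.
Context {R : realType} {M : von_neumann_algebra R} (tau : {scalar M}).
Hypothesis Htau : faithful_normal_tracial_state tau.
Implicit Types (a b c p u v : M) (S : set M).
Local Notation "N2[ a ]" := (norm2 tau a) (format "N2[ a ]").

Lemma star_algebra_gen_subalgebra S : star_subalgebra (star_algebra_gen S).
Proof.
split=> [B [[]]//|z a b ga gb B BS|a b ga gb B BS|a ga B BS].
- by have [[_ H _ _] _] := BS; apply: H; [exact: ga|exact: gb].
- by have [[_ _ H _] _] := BS; apply: H; [exact: ga|exact: gb].
- by have [[_ _ _ H] _] := BS; apply: H; exact: ga.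
Qed.

Lemma sub_star_algebra_gen S a : S a -> star_algebra_gen S a.
Proof. by move=> Sa B [_]; exact. Qed.

Lemma star_subalgebra_center S a : star_subalgebra S -> S a -> S (a - tau a *: 1).
Proof.
by move=> [S1 SD _ _] Sa; rewrite addrC -scaleNr; exact: SD.
Qed.

Lemma free_family2 (I : Type) (B : I -> set M) (i j : I) a b :
  free_family tau B -> i <> j -> B i a -> B j b -> tau a = 0 -> tau b = 0 ->
  tau (a * b) = 0.
Proof.
move=> fB ij Ba Bb a0 b0.
have := fB 1%N (fun n => if n is 0 then i else j) (fun n => if n is 0 then a else b).
rewrite big_ord_recl big_ord1 /=; apply; first by case=> [|[]].
by case=> // n; rewrite ltnS ltn0.
Qed.

(** Centring [b] alone suffices: the centred part of [a] gives an alternating word, and its mean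
    multiplies [tau b = 0]. *)
Lemma free_pair_mul S1 S2 a b : free_pair tau S1 S2 -> star_subalgebra S1 ->
  S1 a -> S2 b -> tau b = 0 -> tau (a * b) = 0.
Proof.
move=> f12 sS1 S1a S2b b0.
have -> : a * b = (a - tau a *: 1) * b + tau a *: b.
  by rewrite mulrBl -scalerAl mul1r subrK.
rewrite raddfD /= tauZ b0 mulr0 addr0.
apply: (free_family2 f12 (i := true) (j := false)) => //.
- exact: star_subalgebra_center.
- exact: tau_center.
Qed.

Lemma free_pair4 S1 S2 a b : free_pair tau S1 S2 -> star_subalgebra S2 ->
  S1 a -> S2 b -> tau a = 0 -> tau b = 0 -> tau (a * star b * a * b) = 0.
Proof.
move=> f12 [_ _ _ sS2] S1a S2b a0 b0.
(* The letters at positions 0 to 3 are [a], [star b], [a], [b]; [~~ odd n] selects the first algebra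
   at even positions. *)
have := f12 3 (fun n => ~~ odd n)
  (fun n => if n is 1 then star b else if odd n then b else a).
rewrite !big_ord_recl big_ord0 /= mulr1 !mulrA; apply.
  case=> [|[|[|[]]]]//= _; split=> //; first exact: sS2.
  by rewrite tau_star// b0 conjc0.
by move=> j _ /=; case: odd.
Qed.

Lemma free_pair_sym S1 S2 : free_pair tau S1 S2 -> free_pair tau S2 S1.
Proof.
move=> f12 m i a Ha Hi; apply: (f12 m (fun n => ~~ i n)) => j /[dup] jm.
  by move=> /Ha; case: (i j).
by move=> /Hi; case: (i j); case: (i j.+1).
Qed.

(** Here [k] is the trace of [p]. Splitting [p] into its centred part [q] and the scalar [k] expands
    |p v p|^2 into four traces; freeness kills the three that contain [q], and k^2 |v|^2 remains. *)
Lemma norm2_compress_free S1 S2 p v (k : R) :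
  free_pair tau S1 S2 -> star_subalgebra S1 -> star_subalgebra S2 ->
  projection p -> S1 p -> S2 v -> tau p = k%:C -> tau v = 0 -> 0 <= k ->
  N2[p * v * p] <= k * N2[v].
Proof.
move=> f12 sS1 sS2 [sp pp] S1p S2v tp v0 k0.
have [_ _ mS2 starS2] := sS2.
have f21 := free_pair_sym f12.
apply: norm2_le => //; first by rewrite mulr_ge0// norm2_ge0.
set q := p - k%:C *: 1.
have q0 : tau q = 0 by rewrite /q -tp tau_center.
have S1q : S1 q by rewrite /q -tp; exact: star_subalgebra_center.
have qy y : S2 y -> tau (q * y) = 0.
  by move=> S2y; rewrite (tau_trace Htau); exact: (free_pair_mul f21).
have -> : tau (star (p * v * p) * (p * v * p)) = tau (p * star v * p * v).
  rewrite !starM sp !mulrA (tau_trace Htau _ p) !mulrA pp.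
  by rewrite -(mulrA _ p p) pp.
have pE : p = q + k%:C *: 1 by rewrite /q subrK.
clearbody q.
have -> : p * star v * p * v = q * star v * q * v + k%:C *: (q * (star v * v)) +
    k%:C *: (star v * q * v) + (k ^+ 2)%:C *: (star v * v).
  rewrite pE !mulrDl !mulr_algl !mulrDr !mulr_algr !mulrDl -!scalerAl !scalerA.
  by rewrite rmorphXn /= -expr2 !mulrA !addrA.
rewrite !raddfD /= !tauZ (free_pair4 f12)// add0r.
rewrite qy; last by apply: mS2 => //; exact: starS2.
rewrite -mulrA (tau_trace Htau) -mulrA qy; last by apply: mS2 => //; exact: starS2.
by rewrite !mulr0 !add0r -sqr_norm2// -rmorphM /= exprMn.
Qed.

End Freeness.

(** * Moments of the normalised sum and of the compression *)

Section Moments.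
Context {R : realType} {M : von_neumann_algebra R} (tau : {scalar M}).
Hypothesis Htau : faithful_normal_tracial_state tau.
Implicit Types (a b p u v : M) (S : set M) (t : R).
Local Notation "N2[ a ]" := (norm2 tau a) (format "N2[ a ]").

Lemma same_star_distribution_tau (Y Z : R -> M) t :
  same_star_distribution tau Y Z -> 0 <= t -> tau (Y t) = tau (Z t).
Proof.
move=> YZ t0; have := YZ [:: (t, false)]; rewrite !big_cons !big_nil /= !mulr1.
by apply=> x; rewrite inE => /eqP ->.
Qed.

(** The squared seminorm of [star (Y t) * Y t - 1] involves only star-moments of lengths 2 and 4.
    These take the value 1 for [Z t], hence for [Y t], and faithfulness concludes. *)
Lemma same_star_distribution_isometry (Y Z : R -> M) t :
  same_star_distribution tau Y Z -> 0 <= t -> star (Z t) * Z t = 1 ->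
  star (Y t) * Y t = 1.
Proof.
move=> YZ t0 ZZ; apply/eqP; rewrite -subr_eq0; apply/eqP; apply: (tau_faithful Htau).
have wt (w : seq (R * bool)) : (forall x, x \in w -> x = (t, true) \/ x = (t, false)) ->
    forall x, x \in w -> 0 <= x.1 by move=> H x /H[]->.
have H2 : tau (star (Y t) * Y t) = 1.
  have := YZ [:: (t, true); (t, false)].
  rewrite !big_cons !big_nil /= !mulr1 ZZ (tau1 Htau); apply; apply: wt => x.
  by rewrite !inE => /orP[]/eqP; [left|right].
have H4 : tau (star (Y t) * Y t * (star (Y t) * Y t)) = 1.
  have := YZ [:: (t, true); (t, false); (t, true); (t, false)].
  rewrite !big_cons !big_nil /= !mulr1 ZZ mulr1 ZZ (tau1 Htau) mulrA; apply.
  apply: wt => x; rewrite !inE.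
  by case/or4P => /eqP; [left|right|left|right].
rewrite starB starM starK star1 mulrBl !mulrBr !mulr1 mul1r !raddfB /=.
by rewrite H2 H4 (tau1 Htau) !subrr addr0.
Qed.

Lemma projection1 : projection (1 : M).
Proof. by split; [exact: star1|rewrite mulr1]. Qed.

(** Centred elements of distinct free algebras are orthogonal, so squares add up: [k] terms of
    seminorm at most 1 sum to at most sqrt k, before division by [k]. *)
Lemma norm2_mean_sub k (B : 'I_k -> set M) (Y : 'I_k -> M) (c : R[i]) :
  (0 < k)%N -> free_family tau B -> (forall j, star_subalgebra (B j)) ->
  (forall j, B j (Y j)) -> (forall j, star (Y j) * Y j = 1) ->
  (forall j, tau (Y j) = c) ->
  N2[(k%:R^-1)%:C *: (\sum_j Y j) - c *: 1] <= (Num.sqrt k%:R)^-1.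
Proof.
move=> k0 fB sB BY YY Yc.
have kR0 : (k%:R : R) != 0 by rewrite pnatr_eq0 -lt0n.
have kC0 : (k%:R : R[i]) != 0 by rewrite pnatr_eq0 -lt0n.
pose v j := Y j - c *: 1.
have Bv j : B j (v j) by rewrite /v -(Yc j); exact: star_subalgebra_center.
have v0 j : tau (v j) = 0 by rewrite /v -(Yc j) tau_center.
have vle j : N2[v j] <= 1.
  rewrite /v -(Yc j); apply: le_trans (norm2_center Htau _) _.
  by rewrite /norm2 YY (tau1 Htau) /= sqrtr1.
have -> : (k%:R^-1)%:C *: (\sum_j Y j) - c *: 1 = (k%:R^-1)%:C *: (\sum_j v j).
  rewrite sumrB sumr_const card_ord scalerBr; congr (_ - _).
  by rewrite -(scaler_nat k (c *: 1)) !scalerA fmorphV rmorph_nat mulKf.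
have orth i j : i != j -> tau (star (v i) * v j) = 0.
  move=> /eqP ij; apply: (free_family2 fB ij) => //.
    by have [_ _ _] := sB i; apply.
  by rewrite tau_star// v0 conjc0.
have S : N2[\sum_j v j] <= Num.sqrt k%:R.
  rewrite -(@ler_pXn2r _ 2)// ?nnegrE ?norm2_ge0 ?sqrtr_ge0// [leRHS]sqr_sqrtr//.
  rewrite (sqr_norm2_sum_orthogonal Htau orth)// -[leRHS]mulr1 -[in leRHS](card_ord k).
  rewrite mulr_natl -sumr_const ler_sum// => j _.
  by rewrite exprn_ile1// norm2_ge0.
rewrite norm2Zr// ger0_norm//; apply: le_trans (ler_wpM2l _ S) _ => //.
by rewrite -{1}(sqr_sqrtr (ler0n R k)) expr2 invfM mulfVK// sqrtr_eq0 -ltNge ltr0n.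
Qed.

Lemma tau_mean_powers_sub k (B : 'I_k -> set M) (Y : 'I_k -> M) (c : R) n :
  (0 < k)%N -> free_family tau B -> (forall j, star_subalgebra (B j)) ->
  (forall j, B j (Y j)) -> (forall j, star (Y j) * Y j = 1) ->
  (forall j, tau (Y j) = c%:C) -> 0 <= c -> c <= 1 ->
  `|tau ((k%:R ^+ (2 * n))^-1 *: ((\sum_j Y j) * star (\sum_j Y j)) ^+ n)
    - (c ^+ (2 * n))%:C| <=
  ((2 * n)%:R / Num.sqrt k%:R)%:C.
Proof.
move=> k0 fB sB BY YY Yc c0 c1.
set G := \sum_j Y j; pose b := (k%:R^-1)%:C *: G.
have cb : L2contraction tau b.
  by apply: L2contraction_mean => // j; exact: L2contraction_isometry.
have := tau_powers_sub Htau projection1 cb (mul1r _) (mulr1 _) c0 c1 n.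
rewrite (tau1 Htau) mulr1 mul1r norm21// mul1r.
have -> : (b * star b) ^+ n = (k%:R ^+ (2 * n))^-1 *: (G * star G) ^+ n.
  rewrite /b starZ -scalerAl -scalerAr scalerA exprZn; congr (_ *: _).
  rewrite fmorphV rmorph_nat conjc_inv conjc_nat -expr2 -exprM.
  by rewrite exprVn.
move/le_trans; apply; rewrite lecR ler_wpM2l//.
exact: (norm2_mean_sub k0 fB).
Qed.

Lemma compressed_moment_sub (p u : M) S k (c : R) n : (0 < k)%N ->
  projection p -> tau p = k%:R^-1 -> star_subalgebra S ->
  free_pair tau (star_algebra_gen [set p]) S -> S u -> star u * u = 1 ->
  tau u = c%:C -> 0 <= c -> c <= 1 ->
  `|compressed_moment tau p (p * u * p * star u * p) n - (c ^+ (2 * n))%:C| <=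
  ((2 * n)%:R / Num.sqrt k%:R)%:C.
Proof.
move=> k0 /[dup] pp [sp p2] tp sS fp Su uu tu c0 c1.
have kR0 : 0 < (k%:R : R) by rewrite ltr0n.
have kC0 : (k%:R : R[i]) != 0 by rewrite pnatr_eq0 -lt0n.
pose b := p * u * p.
have cb : L2contraction tau b.
  apply: L2contractionM => //; last exact: L2contraction_projection.
  apply: L2contractionM; first exact: L2contraction_projection.
  exact: L2contraction_isometry.
have pb : p * b = b by rewrite /b !mulrA p2.
have bp : b * p = b by rewrite /b -mulrA p2.
have tp' : tau p = (k%:R^-1)%:C by rewrite tp fmorphV rmorph_nat.
have bE : p * u * p * star u * p = b * star b.
  by rewrite /b !starM sp !mulrA -(mulrA _ p p) p2.
(* [b - c p] compresses the centred element [u - c]: freeness yields the factor [tau p = 1/k], and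
   |u - c| <= |u| = 1. *)
have bc : N2[b - c%:C *: p] <= k%:R^-1.
  have -> : b - c%:C *: p = p * (u - c%:C *: 1) * p.
    by rewrite mulrBr mulrBl -scalerAr mulr1 -scalerAl p2.
  apply: le_trans (_ : k%:R^-1 * N2[u - c%:C *: 1] <= _).
    apply: (norm2_compress_free Htau fp) => //.
    - exact: star_algebra_gen_subalgebra.
    - exact: sub_star_algebra_gen.
    - by rewrite -tu; exact: star_subalgebra_center.
    - by rewrite -tu tau_center.
  rewrite ler_piMr ?invr_ge0// -tu; apply: le_trans (norm2_center Htau _) _.
  by rewrite /norm2 uu (tau1 Htau) /= sqrtr1.
have np : N2[p] = (Num.sqrt k%:R)^-1 by rewrite /norm2 sp p2 tp' /= sqrtrV.
rewrite /compressed_moment bE.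
have -> : (tau p)^-1 * tau (p * (b * star b) ^+ n) - (c ^+ (2 * n))%:C =
    (tau p)^-1 * (tau (p * (b * star b) ^+ n) - (c ^+ (2 * n))%:C * tau p).
  by rewrite mulrBr tp invrK mulrCA mulfV// mulr1.
rewrite normrM tp invrK normr_nat.
have := tau_powers_sub Htau pp cb pb bp c0 c1 n.
rewrite tp => /(ler_wpM2l (ler0n R[i] k))/le_trans; apply.
rewrite -(rmorph_nat (real_complex R)) -rmorphM /= lecR np.
(* The factor [k] coming from [(tau p)^-1] is absorbed by |b - c p| <= 1/k; what survives is |p| =
   k^(-1/2). *)
have -> N : k%:R * ((Num.sqrt k%:R)^-1 * ((2 * n)%:R * N)) =
  ((2 * n)%:R / Num.sqrt k%:R) * (k%:R * N) :> R by ring.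
rewrite ler_piMr ?divr_ge0 ?sqrtr_ge0//.
by rewrite -[leRHS](mulfV (lt0r_neq0 kR0)) ler_wpM2l.
Qed.

End Moments.

(** * Integrals and a linear integral equation *)

Section Analysis.
Context {R : realType}.
Implicit Types (t : R).
Local Notation mu := (@lebesgue_measure R).

(* No measurability is required, unlike in [ge0_le_integral]. *)
Lemma ge0_le_lower_integral d (T : measurableType d) (m : {measure set T -> \bar R})
    (D : set T) (f g : T -> \bar R) :
  (forall x, D x -> 0 <= f x)%E -> (forall x, D x -> f x <= g x)%E ->
  (\int[m]_(x in D) f x <= \int[m]_(x in D) g x)%E.
Proof.
move=> f0 fg; have fgD x : ((f \_ D) x <= (g \_ D) x)%E.
  by rewrite /patch; case: ifPn => // /set_mem; exact: fg.
have f0D x : (0 <= (f \_ D) x)%E.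
  by rewrite /patch; case: ifPn => // /set_mem; exact: f0.
have g0D x : (0 <= (g \_ D) x)%E := le_trans (f0D x) (fgD x).
rewrite integral_mkcond [leRHS]integral_mkcond !ge0_integralTE//.
apply: ereal_sup_le => _ [h /= hf <-]; exists h => // x.
exact: le_trans (hf x) (fgD x).
Qed.

Lemma continuous_integrable_itv (f : R -> R) (a b : R) :
  continuous f -> mu.-integrable `[a, b] (EFin \o f).
Proof.
move=> cf; apply: continuous_compact_integrable; first exact: segment_compact.
exact: continuous_subspaceT.
Qed.

Lemma Rintegral_odd (f : R -> R) (a : R) : 0 <= a -> continuous f ->
  (forall x, f (- x) = - f x) -> \int[mu]_(x in `[(- a), a]) f x = 0.
Proof.
move=> a0 cf fN.
have aa : - a <= a by rewrite (le_trans _ a0)// oppr_le0.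
have := @integration_by_substitution_oppr R f (- a) a aa.
rewrite opprK => /(_ (continuous_subspaceT cf)) H.
suff : \int[mu]_(x in `[(- a), a]) f x = - \int[mu]_(x in `[(- a), a]) f x.
  by move/eqP; rewrite -addr_eq0 -mulr2n mulrn_eq0 /= => /eqP.
rewrite {1}/Rintegral H -[RHS]mulN1r -RintegralZl//; last exact: continuous_integrable_itv.
by congr fine; apply: eq_integral => x _ /=; rewrite fN mulN1r.
Qed.

Lemma step_function_integral (m : nat) (p y : nat -> R) t :
  (forall i, (i < m)%N -> [/\ 0 <= p i, p i <= p i.+1 & p i.+1 <= t]) ->
  let h := fun s : R => \sum_(i < m) y i * (p i <= s < p i.+1)%R%:R in
  mu.-integrable `[0, t] (EFin \o h) /\
  \int[mu]_(s in `[0, t]) h s = \sum_(i < m) y i * (p i.+1 - p i).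
Proof.
move=> pP h.
have mI : measurable (`[0, t]%classic : set (measurableTypeR R)) by exact: measurable_itv.
pose e i s : R := \1_`[p i, p i.+1[ s.
have hE s : (h s)%:E = (\sum_(i < m) (y i * e i s)%:E)%E.
  rewrite sumEFin; congr EFin; apply: eq_bigr => i _; congr (_ * _).
  by rewrite /e indicE mem_setE in_itv.
have ie i : mu.-integrable `[0, t] (EFin \o e i).
  apply: (integrableS measurableT) => //; exact: integrable_indic_itv.
have iye i : mu.-integrable `[0, t] (EFin \o (fun s => y i * e i s)).
  have := integrableZl mI (y i) (ie i).
  by apply: eq_integrable.
split.
  have := @integrable_sum _ _ _ mu _ mI _ (index_enum 'I_m) predT
    (fun i => EFin \o (fun s => y i * e i s)).
  move=> /(_ (fun i _ => iye i)); apply: eq_integrable => //.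
  by move=> s _; rewrite /= hE.
rewrite /Rintegral; under eq_integral do rewrite hE.
have := @integral_sum _ _ _ mu _ mI _ (fun (i : 'I_m) s => (y i * e i s)%:E) iye
  (index_enum 'I_m) predT => /= ->.
rewrite -[RHS]/(fine (EFin _)) -sumEFin; congr fine; apply: eq_bigr => i _.
have [p0 pp pt] := pP i (ltn_ord i).
under eq_integral do rewrite EFinM.
rewrite integralZl//; last exact: ie.
rewrite EFinM; congr (_ * _)%E; rewrite /e integral_indic//.
rewrite setIidl; last first.
  move=> s /=; rewrite !in_itv /= => /andP[ps sp].
  by rewrite (le_trans p0 ps) (le_trans (ltW sp) pt).
etransitivity; first exact: lebesgue_measure_itv.
(* The measure of an interval is given by cases; when its ends coincide it is 0, which is also their
   difference. *)
rewrite /= lte_fin; case: ltP => [_|pp']; first by rewrite EFinB.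
by congr EFin; apply/esym/eqP; rewrite subr_eq0 eq_le pp pp'.
Qed.

(** By the fundamental theorem of calculus [expR (a * x) * f x] has zero derivative on the open
    interval, so the mean value theorem equates its values at 0 and [t]. *)
Lemma linear_integral_equation (f : R -> R) (a : R) : continuous f ->
  (forall t, 0 <= t -> f t = f 0 - a * \int[mu]_(s in `[0, t]) f s) ->
  forall t, 0 <= t -> f t = f 0 * expR (- (a * t)).
Proof.
move=> cf fE t t0.
pose H x := expR (a * x) * f x.
have cE : continuous (fun x : R => expR (a * x)).
  move=> x; apply: continuous_comp; last exact: continuous_expR.
  exact: mulrl_continuous.
have cH : continuous H by move=> x; apply: cvgM; [exact: cE|exact: cf].
have dH x : x \in `]0, t[%R -> is_derive x 1 H 0.
  rewrite in_itv /= => /andP[x0 xt].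
  have [dI I'] := @continuous_FTC1 R f (BLeft 0) x t xt
    (continuous_integrable_itv _ _ cf) x0 (cf x).
  set I := (fun x => \int[mu]_(s in `[0, x]) f s) in dI I'.
  have dI' : is_derive x 1 I (f x) by rewrite -I' derive1E; exact: DeriveDef.
  (* The integral equation is available at nonnegative points, hence on a neighbourhood of
     [x > 0]. *)
  have df : is_derive x 1 f (- (a * f x)).
    have := is_deriveB (is_derive_cst (f 0) x 1) (is_deriveZ a dI').
    rewrite sub0r; apply: near_eq_is_derive.
    near=> y; rewrite [RHS]fE// ltW//; near: y.
    exact: lt_nbhsr.
  have dE : is_derive x 1 (expR \o (a \*: id)) (a * expR (a * x)).
    have := is_derive1_comp (is_derive_expR (a * x)) (is_deriveZ a (is_derive_id x 1)).
    by rewrite /GRing.scale /= mulr1 mulrC.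
  have := is_deriveM dE df; congr is_derive.
  by rewrite /GRing.scale /=; ring.
have [c _] := MVT_segment t0 dH (continuous_subspaceT cH).
rewrite mul0r => /eqP; rewrite subr_eq0 /H mulr0 expR0 mul1r => /eqP <-.
by rewrite expRN mulrC mulKf// gt_eqF// expR_gt0.
Unshelve. all: by end_near.
Qed.

End Analysis.

(** * Mean of the free unitary Brownian motion *)

Section SDE.
Context {R : realType} {M : von_neumann_algebra R} (tau : {scalar M}).
Hypothesis Htau : faithful_normal_tracial_state tau.
Implicit Types (a b : M) (F : R -> set M) (X Y U : R -> M) (Z : @step_process R M) (t : R).
Local Notation "N2[ a ]" := (norm2 tau a) (format "N2[ a ]").
Local Notation mu := (@lebesgue_measure R).

(** The density is even, so the first moment integrates an odd function over a symmetric
    interval. *)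
Lemma semicircular_mean0 (v : R) a : semicircular tau v a -> tau a = 0.
Proof.
move=> [_ /(_ 1)]; rewrite expr1 => ->.
rewrite Rintegral_odd ?mulr_ge0 ?sqrtr_ge0//; last by move=> y; rewrite !expr1 sqrrN mulNr.
move=> y; apply: cvgM; first exact: exprn_continuous.
apply: cvgMl; apply: continuous_comp; last exact: sqrt_continuous.
by apply: cvgB; [exact: cvg_cst|exact: exprn_continuous].
Qed.

Lemma step_time_bounds t Z : step_on t Z -> forall i, (i < step_size Z)%N ->
  [/\ 0 <= step_time Z i, step_time Z i <= step_time Z i.+1 & step_time Z i.+1 <= t].
Proof.
move=> [Z0 Zt Zm] i ilt; split; last 2 first.
- exact: Zm.
- rewrite -Zt; have : (i.+1 <= step_size Z)%N by [].
  elim: (step_size Z) Zm => // m IH Zm.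
  rewrite leq_eqVlt => /predU1P[->//|im].
  apply: le_trans (Zm m _) => //; apply: IH => // j jm.
  by apply: Zm; rewrite ltnW.
- elim: i ilt => [|i IH] ilt; first by rewrite Z0.
  by rewrite (le_trans (IH _))// ?Zm// ltnW.
Qed.

(** A step value lies in the filtration at the left end of its interval, from which the centred
    increment is free; every summand thus has zero trace. *)
Lemma tau_step_ito0 F X Z t : filtration F -> free_additive_BM tau F X ->
  step_on t Z -> step_adapted F Z -> tau (step_ito X Z) = 0.
Proof.
move=> [vF _] [_ _ incX] Zt ZF; rewrite /step_ito raddf_sum big1// => i _ /=.
have [s0 + _] := step_time_bounds Zt (ltn_ord i).
(* The law of increments concerns nondegenerate intervals only; a repeated time contributes 0. *)
rewrite le_eqVlt => /predU1P[->|st]; first by rewrite subrr mulr0 raddf0.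
have [sc free] := incX _ _ s0 st.
apply: (free_pair_mul Htau free).
- by have [] := vF _ s0.
- exact: ZF.
- exact: sub_star_algebra_gen.
- exact: semicircular_mean0 sc.
Qed.

(** Since step integrals have zero trace, |tau a| is at most the distance from [a] to each of them,
    which tends to 0. *)
Lemma tau_ito_integral0 F X Y t a : filtration F -> free_additive_BM tau F X ->
  is_ito_integral tau F X Y t a -> tau a = 0.
Proof.
move=> FF BX [Z [Zt _ Zcvg]].
apply/eqP; rewrite -normr_eq0 eq_le normr_ge0 andbT.
have : forall n, `|tau a| <= (N2[a - step_ito X (Z n)])%:C.
  move=> n; have [Zn ZF] := Zt n.
  have := norm_tau_le Htau (a - step_ito X (Z n)).
  by rewrite raddfB /= (tau_step_ito0 FF BX Zn ZF) subr0.
rewrite normc_def => H; rewrite (lecR _ 0).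
have H' n : Num.sqrt (complex.Re (tau a) ^+ 2 + complex.Im (tau a) ^+ 2) <=
    N2[a - step_ito X (Z n)] by rewrite -lecR.
by apply: (cvgr_to_ge Zcvg); exact: nearW.
Qed.

Section Functional.
Variable L : {additive M -> R}.
Hypotheses (LZ : forall (r : R) a, L (r%:C *: a) = r * L a)
  (Lle : forall a, `|L a| <= N2[a]).

(** [L] will be the real or the imaginary part of [tau], so that only real integrals occur. The two
    sides differ by at most |a - step_integral (Z n)| plus the integral of |Y - step_eval (Z n)|,
    and both terms tend to 0. *)
Lemma time_integral_functional Y t a : 0 <= t ->
  mu.-integrable `[0, t] (EFin \o (L \o Y)) ->
  is_time_integral tau Y t a -> L a = \int[mu]_(s in `[0, t]) L (Y s).
Proof.
move=> t0 intY [Z [Zt Ycvg acvg]].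
have Zint n : mu.-integrable `[0, t] (EFin \o (L \o step_eval (Z n))) /\
    \int[mu]_(s in `[0, t]) L (step_eval (Z n) s) = L (step_integral (Z n)).
  have [] := step_function_integral (fun i => L (step_val (Z n) i)) (step_time_bounds (Zt n)).
  rewrite (_ : (fun s => \sum_(_ < _) _) = L \o step_eval (Z n)); last first.
    apply/funext => s; rewrite /step_eval /= raddf_sum; apply: eq_bigr => i _ /=.
    by case: ifP; rewrite ?mulr1 ?mulr0 ?raddf0.
  move=> ih Ih; split=> //; rewrite Ih /step_integral raddf_sum.
  by apply: eq_bigr => i _ /=; rewrite LZ mulrC.
apply/eqP; rewrite -subr_eq0 -normr_le0; apply/ler_addgt0Pr => e e0; rewrite add0r.
have e2 : 0 < e / 2 by rewrite divr_gt0.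
near \oo => n.
have [ih Ih] := Zint n.
have -> : L a - \int[mu]_(s in `[0, t]) L (Y s) = L (a - step_integral (Z n)) -
    \int[mu]_(s in `[0, t]) (L (Y s) - L (step_eval (Z n) s)).
  by rewrite raddfB RintegralB//= Ih opprB addrA subrK.
apply: le_trans (ler_normB _ _) _; rewrite [leRHS](splitr e) lerD//.
  apply: le_trans (Lle _) _; near: n.
  move/cvgrPdist_le : acvg => /(_ _ e2); apply: filterS => n.
  by rewrite sub0r normrN; apply: le_trans (ler_norm _).
have int2 : mu.-integrable `[0, t] (EFin \o (fun s => L (Y s) - L (step_eval (Z n) s))).
  exact: (integrableB _ intY ih).
apply: le_trans (le_normr_Rintegral _ int2) _ => //.
rewrite -lee_fin /Rintegral fineK; last first.
  apply: integrable_fin_num => //; exact: (integrable_abse int2).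
(* Measurability of the seminorm along the process is not assumed, hence the comparison of lower
   integrals. *)
apply: (@le_trans _ _ (\int[mu]_(s in `[0%R, t]) (N2[Y s - step_eval (Z n) s])%:E)%E).
  apply: ge0_le_lower_integral => s _; first by rewrite lee_fin.
  by rewrite lee_fin -raddfB Lle.
(* Convergence in the extended reals makes the integrals eventually finite, so [fine] loses
   nothing. *)
near: n; move/fine_cvgP : Ycvg => [Yfin /cvgr_le/(_ _ e2)].
apply: filterS2 Yfin => n /= fin_n; rewrite -lee_fin fineK//.
Unshelve. all: by end_near.
Qed.

End Functional.

(** The third condition on [L] removes the stochastic integral, whose trace is 0; what remains is
    the linear equation f(t) = f(0) - 1/2 int_0^t f for f = L(U). *)
Lemma ito_functional (L : {additive M -> R}) F X U :
  (forall (r : R) a, L (r%:C *: a) = r * L a) ->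
  (forall a, `|L a| <= N2[a]) -> (forall a, tau a = 0 -> L ('i%C *: a) = 0) ->
  filtration F -> free_additive_BM tau F X -> free_unitary_SDE tau F X U ->
  forall t, 0 <= t -> L (U t) = L 1 * expR (- (t / 2)).
Proof.
move=> LZ Lle Li FF BX [U0 _ Uc Ueq] t t0.
(* Freezing the process at time 0 for negative times gives a function continuous on the whole
   line. *)
pose f s := L (U (Num.max 0 s)).
have fU s : 0 <= s -> f s = L (U s) by move=> s0; rewrite /f max_r.
have cf : continuous f.
  move=> s; apply/cvgrPdist_lt => e e0.
  have s0 : 0 <= Num.max 0 s by rewrite le_max lexx.
  have mc : Num.max 0 x @[x --> s] --> Num.max 0 s.
    by apply: (@continuous_max _ R^o (cst 0) id s); [exact: cvg_cst|exact: cvg_id].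
  have /cvgrPdist_lt/(_ _ e0) := Uc _ s0.
  rewrite near_withinE => /mc H.
  have {}H : \forall x \near s, 0 <= Num.max 0 x ->
    `|0 - N2[U (Num.max 0 x) - U (Num.max 0 s)]| < e := H.
  suff : \forall x \near s, `|f s - f x| < e by [].
  move: H; apply: filterS => x; rewrite le_max lexx /=.
  move=> /(_ isT); apply: le_lt_trans.
  by rewrite distrC sub0r normrN /f -raddfB (le_trans (Lle _))// ler_norm.
have fE s : 0 <= s -> f s = f 0 - 2^-1 * \int[mu]_(r in `[0, s]) f r.
  move=> s0; rewrite fU//; have [J [D [HJ HD ->]]] := Ueq _ s0.
  have fI : \int[mu]_(r in `[0, s]) f r = L D.
    rewrite (time_integral_functional LZ Lle s0 _ HD); last first.
      apply: eq_integrable (continuous_integrable_itv 0 s cf) => //.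
      by move=> r; rewrite inE /= in_itv /= => /andP[r0 _]; rewrite fU.
    apply: eq_Rintegral => r; rewrite inE /= in_itv /= => /andP[r0 _].
    by rewrite fU.
  rewrite fI raddfB raddfD /= (Li _ (tau_ito_integral0 FF BX HJ)) addr0.
  by rewrite fU// U0 -LZ fmorphV rmorph_nat.
rewrite -fU// (linear_integral_equation cf fE t0) fU// U0.
by rewrite (mulrC t).
Qed.

(** The real and imaginary parts of the trace solve the same equation, starting from 1 and 0. *)
Lemma tau_unitary_BM U t : free_unitary_BM tau U -> 0 <= t ->
  tau (U t) = (expR (- (t / 2)))%:C.
Proof.
move=> [F [X [FF BX SDE]]] t0.
have nle a : Num.sqrt (complex.Re (tau a) ^+ 2 + complex.Im (tau a) ^+ 2) <= N2[a].
  by rewrite -lecR -normc_def; exact: norm_tau_le.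
have Rez (z w : R[i]) : complex.Re (z - w) = complex.Re z - complex.Re w.
  by case: z w => ? ? [].
have Imz (z w : R[i]) : complex.Im (z - w) = complex.Im z - complex.Im w.
  by case: z w => ? ? [].
pose LR a := complex.Re (tau a); pose LI a := complex.Im (tau a).
have LRa : additive LR by move=> a b; rewrite /LR raddfB /= Rez.
have LIa : additive LI by move=> a b; rewrite /LI raddfB /= Imz.
pose addR := GRing.isAdditive.Build _ _ LR LRa.
pose addI := GRing.isAdditive.Build _ _ LI LIa.
pose LRA : {additive M -> R} := HB.pack LR addR.
pose LIA : {additive M -> R} := HB.pack LI addI.
have ER : complex.Re (tau (U t)) = expR (- (t / 2)).
  rewrite -[LHS]/(LRA (U t)) (@ito_functional LRA F X U _ _ _ FF BX SDE t t0).
  - by rewrite /= /LR (tau1 Htau) mul1r.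
  - by move=> r a; rewrite /= /LR tauZ; case: (tau a) => x y /=; rewrite mul0r subr0.
  - move=> a; apply: le_trans (nle a); rewrite /= /LR; case: (tau a) => x y /=.
    by rewrite -sqrtr_sqr ler_wsqrtr// lerDl sqr_ge0.
  - by move=> a a0; rewrite /= /LR tauZ a0 mulr0.
have EI : complex.Im (tau (U t)) = 0.
  rewrite -[LHS]/(LIA (U t)) (@ito_functional LIA F X U _ _ _ FF BX SDE t t0).
  - by rewrite /= /LI (tau1 Htau) mul0r.
  - by move=> r a; rewrite /= /LI tauZ; case: (tau a) => x y /=; rewrite mul0r addr0.
  - move=> a; apply: le_trans (nle a); rewrite /= /LI; case: (tau a) => x y /=.
    by rewrite -sqrtr_sqr ler_wsqrtr// lerDr sqr_ge0.
  - by move=> a a0; rewrite /= /LI tauZ a0 mulr0.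
by apply/eqP; rewrite eq_complex /= ER EI !eqxx.
Qed.

End SDE.

(** * Weak convergence to a Dirac mass *)

Section WeakConvergence.
Context {R : realType}.
Local Notation TR := (measurableTypeR R).

(** The complement of the segment is negligible, and a continuous function is bounded on the
    segment. *)
Lemma integrable_compact_support (m : probability TR R) (C : R) (f : R -> R) :
  m `[- C, C]%classic = 1%E -> continuous f ->
  m.-integrable setT (EFin \o f : TR -> \bar R).
Proof.
move=> mC cf.
have mI : measurable (`[- C, C]%classic : set TR) by exact: measurable_itv.
have mf := continuous_measurable_fun cf.
have mNI : measurable (~` `[- C, C]%classic : set TR) by exact: measurableC.
have /measurable_EFinP mef := mf.
have NI0 : m (~` `[- C, C]%classic) = 0%E by rewrite probability_setC// mC subee.
apply: (iffRL (negligible_integrable mNI measurableT mef NI0)).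
have mfin : (m `[(- C)%R, C]%classic < +oo)%E by rewrite mC ltry.
rewrite setTD setCK; apply: measurable_bounded_integrable => //.
- exact: measurable_funS mf.
have /compact_bounded[N [_ Nb]] : compact (f @` `[- C, C]%classic).
  apply: continuous_compact; last exact: segment_compact.
  exact: continuous_subspaceT.
by exists N; split; rewrite ?num_real // => ? ? ? ?; apply: Nb => //; exists x.
Qed.

Lemma integrable_bounded_continuous (m : probability TR R) (C : R) (f : R -> R) :
  (forall x, `|f x| <= C) -> continuous f ->
  m.-integrable setT (EFin \o f : TR -> \bar R).
Proof.
move=> fC cf; have mT : (m setT < +oo)%E by rewrite probability_setT ltry.
apply: measurable_bounded_integrable => //.
- exact: continuous_measurable_fun.
- by exists C; split; rewrite ?num_real // => x Cx y _; apply: (le_trans (fC y)); exact: ltW.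
Qed.

(** A Chebyshev argument: the second moment about [a] tends to 0, and |f x - f a| is at most a small
    constant plus a multiple of (x - a)^2. Bounded supports make these polynomials integrable. *)
Lemma weakly_converges_dirac (m : nat -> probability TR R) (a : R) :
  (forall k, (2 <= k)%N -> exists C : R, m k `[- C, C]%classic = 1%E) ->
  (\int[m k]_x x) @[k --> \oo] --> a ->
  (\int[m k]_x (x ^+ 2)) @[k --> \oo] --> a ^+ 2 ->
  weakly_converges m (@dirac _ TR a R).
Proof.
move=> supp m1 m2 f cf [C fC].
have -> : \int[@dirac _ TR a R]_x f x = f a.
  rewrite /Rintegral integral_dirac//; last first.
    by apply/measurable_EFinP; exact: continuous_measurable_fun.
  by rewrite diracT mul1e.
have ic k (c : R) : (m k).-integrable setT (EFin \o (fun=> c) : TR -> \bar R).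
  exact: finite_measure_integrable_cst.
have Ic k (c : R) : \int[m k]_x c = c.
  by rewrite Rintegral_cst//= probability_setT mulr1.
have var0 : (\int[m k]_x ((x - a) ^+ 2)) @[k --> \oo] --> (0 : R).
  have -> : (0 : R) = a ^+ 2 - 2 * a * a + a ^+ 2 by ring.
  have H : (\int[m k]_x (x ^+ 2) - 2 * a * \int[m k]_x x + a ^+ 2) @[k --> \oo] -->
      a ^+ 2 - 2 * a * a + a ^+ 2.
    apply: cvgD; last exact: cvg_cst.
    by apply: cvgB => //; apply: cvgM => //; exact: cvg_cst.
  apply: cvg_trans H; apply: near_eq_cvg; exists 2%N => // k /supp[B mB].
  have i1 : (m k).-integrable setT (EFin \o (fun x => x) : TR -> \bar R).
    by apply: (integrable_compact_support mB) => x; exact: cvg_id.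
  have i2 : (m k).-integrable setT (EFin \o (fun x => x ^+ 2) : TR -> \bar R).
    by apply: (integrable_compact_support mB); exact: exprn_continuous.
  have i3 : (m k).-integrable setT (EFin \o (fun x => 2 * a * x) : TR -> \bar R).
    apply: (integrable_compact_support mB) => x.
    by apply: cvgM; [exact: cvg_cst|exact: cvg_id].
  have i4 : (m k).-integrable setT (EFin \o (fun x => x ^+ 2 - 2 * a * x) : TR -> \bar R).
    exact: (integrableB _ i2 i3).
  have -> : \int[m k]_x (x - a) ^+ 2 = \int[m k]_x (x ^+ 2 - 2 * a * x + a ^+ 2).
    by apply: eq_Rintegral => x _; ring.
  by rewrite (RintegralD _ i4 (ic k _))// (RintegralB _ i2 i3)// RintegralZl// Ic.
apply/cvgrPdist_le => e e0.
have e2 : 0 < e / 2 by rewrite divr_gt0.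
have /cvgrPdist_lt/(_ _ e2)/nbhs_ballP[d /= d0 fd] := cf a.
(* Chosen so that |x - a| >= d implies |f x - f a| <= 2 C <= K (x - a)^2. *)
pose K := 2 * C / d ^+ 2.
have C0 : 0 <= C by exact: le_trans (normr_ge0 _) (fC 0).
have K0 : 0 <= K by rewrite !mulr_ge0// invr_ge0 sqr_ge0.
have fK x : `|f x - f a| <= e / 2 + K * (x - a) ^+ 2.
  have [xd|dx] := ltP `|a - x| d.
    apply: ler_wpDr; first by rewrite mulr_ge0 ?sqr_ge0.
    by rewrite distrC ltW//; exact: fd.
  apply: (@le_trans _ _ (K * (x - a) ^+ 2)); last by rewrite lerDr ltW.
  apply: (@le_trans _ _ (2 * C)).
    by rewrite (le_trans (ler_normB _ _))// mulr_natl mulr2n lerD.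
  rewrite /K mulrAC -mulrA ler_peMr ?mulr_ge0//.
  rewrite ler_pdivlMr ?exprn_gt0// mul1r -(real_normK (num_real (x - a))) distrC.
  by rewrite lerXn2r// nnegrE ?ltW// normr_ge0.
have Ke : \forall k \near \oo, K * \int[m k]_x ((x - a) ^+ 2) <= e / 2.
  have : (K * \int[m k]_x ((x - a) ^+ 2)) @[k --> \oo] --> K * 0.
    by apply: cvgM => //; exact: cvg_cst.
  by rewrite mulr0 => /cvgr_le; apply.
near=> k.
have [B mB] : exists B : R, m k `[- B, B]%classic = 1%E.
  by apply: supp; near: k; exists 2.
have csq : continuous (fun x : R => (x - a) ^+ 2).
  have cB : continuous (fun x : R => x - a).
    by move=> x; apply: cvgB; [exact: cvg_id|exact: cvg_cst].
  move=> x; exact: (continuous_comp (cB x) (@exprn_continuous R 2 (x - a))).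
have if1 := integrable_bounded_continuous (m k) fC cf.
have isq := integrable_compact_support mB csq.
have -> : f a - \int[m k]_x f x = - \int[m k]_x (f x - f a).
  by rewrite (RintegralB _ if1 (ic _ _))// Ic opprB.
have ifB : (m k).-integrable setT (EFin \o (fun x => f x - f a) : TR -> \bar R).
  exact: (integrableB _ if1 (ic _ _)).
rewrite normrN; apply: le_trans (le_normr_Rintegral _ ifB) _ => //.
have iK : (m k).-integrable setT (EFin \o (fun x => K * (x - a) ^+ 2) : TR -> \bar R).
  apply: (integrable_compact_support mB) => x.
  by apply: cvgM; [exact: cvg_cst|exact: csq].
apply: (@le_trans _ _ (\int[m k]_x (e / 2 + K * (x - a) ^+ 2))).
  apply: le_Rintegral => //.
  - exact: (integrable_abse ifB).
  - exact: (integrableD _ (ic _ _) iK).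
rewrite (RintegralD _ (ic _ _) iK)// Ic (RintegralZl _ _ isq)// [leRHS](splitr e) lerD2l.
by near: k.
Unshelve. all: by end_near.
Qed.

End WeakConvergence.

(** * Passage to the limit *)

Lemma cvg_rsqrt_bound (R : realType) (u : nat -> R[i]) (l : R[i]) (C : R) :
  0 <= C -> (forall k, (2 <= k)%N -> `|u k - l| <= (C / Num.sqrt k%:R)%:C) ->
  (u : nat -> R[i]^o) @ \oo --> (l : R[i]^o).
Proof.
move=> C0 ul; apply/cvgrPdist_le => e; rewrite ltcE /= => /andP[/eqP ei er].
(* A positive element of [R[i]] is real, so the tolerance can be treated as a real number. *)
have eE : e = (complex.Re e)%:C by apply/eqP; rewrite eq_complex /= ei !eqxx.
set r := complex.Re e in er eE.
near=> k.
rewrite distrC eE; apply: le_trans (ul k _) _; first by near: k; exists 2%N.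
have k0 : 0 < (k%:R : R) by rewrite ltr0n; near: k; exists 1%N.
(* The bound C / sqrt k <= r holds as soon as k >= (C / r)^2. *)
rewrite lecR ler_pdivrMr ?sqrtr_gt0// mulrC -ler_pdivrMr//.
rewrite -(ger0_norm (divr_ge0 C0 (ltW er))) -sqrtr_sqr ler_wsqrtr//.
by near: k; exact: nbhs_infty_ger.
Unshelve. all: by end_near.
Qed.

Theorem proposition2 (R : realType) (M : von_neumann_algebra R)
    (tau : {scalar M}) (Htau : faithful_normal_tracial_state tau)
    (U : R -> M) (HU : free_unitary_BM tau U)
    (V : forall k : nat, 'I_k -> R -> M)
    (HV : forall k : nat, (2 <= k)%N -> star_free_copies tau U (V k))
    (P : nat -> M)
    (HP : forall k : nat, (2 <= k)%N -> compressing_projection tau U k (P k)) :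
  let G (k : nat) (t : R) : M := \sum_(j < k) V k j t in
  let W (k : nat) (t : R) : M := G k t * star (G k t) in
  (forall (n : nat) (t : R), 0 <= t ->
     ((fun k : nat => tau ((k%:R ^+ (2 * n))^-1 *: W k t ^+ n) : R[i]^o) @ \oo
        --> (tau (U t) ^+ (2 * n) : R[i]^o)) /\
     tau (U t) ^+ (2 * n) = (expR (- (n%:R * t)))%:C) /\
  (forall t : R, 0 <= t ->
     (forall n : nat,
        (fun k : nat => compressed_moment tau (P k) (free_jacobi (P k) U t) n
           : R[i]^o) @ \oo --> ((expR (- t) ^+ n)%:C : R[i]^o)) /\
     (forall mu : nat -> probability (measurableTypeR R) R,
        (forall k : nat, (2 <= k)%N ->
           compressed_spectral_distribution tau (P k)
             (free_jacobi (P k) U t) (mu k)) ->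
        weakly_converges mu (@dirac _ (measurableTypeR R) (expR (- t)) R))).
Proof.
move=> G W.
have [F [X [_ _ [_ Uunit _ _]]]] := HU.
have tU t : 0 <= t -> tau (U t) = (expR (- (t / 2)))%:C by exact: tau_unitary_BM.
have c1 t : 0 <= t -> expR (- (t / 2)) <= 1.
  by move=> t0; rewrite -expR0 ler_expR oppr_le0 divr_ge0.
(* With c = e^(-t/2), the power c^(2n) of both estimates is the n-th moment of the Dirac mass at
   e^(-t). *)
have cn n t : expR (- (t / 2)) ^+ (2 * n) = expR (- t) ^+ n.
  by rewrite exprM -expRM_natl; congr (expR _ ^+ _); rewrite mulrN mulrC divfK.
have UU t : 0 <= t -> star (U t) * U t = 1 by move=> /Uunit[_ []].
have Jbound k n t : (2 <= k)%N -> 0 <= t ->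
    `|compressed_moment tau (P k) (free_jacobi (P k) U t) n - (expR (- t) ^+ n)%:C| <=
    ((2 * n)%:R / Num.sqrt k%:R)%:C.
  move=> k2 t0; have [Pp tP fP] := HP _ k2.
  rewrite -cn; apply: (compressed_moment_sub Htau n _ Pp tP _ fP) => //.
  - exact: ltnW.
  - exact: star_algebra_gen_subalgebra.
  - by apply: sub_star_algebra_gen; exists t.
  - exact: UU.
  - exact: tU.
  - exact: c1.
split=> [n t t0|t t0].
  split; last first.
    by rewrite tU// -rmorphXn /= cn -expRM_natl mulrN.
  apply: (@cvg_rsqrt_bound _ _ _ (2 * n)%:R) => // k k2.
  have [VU fV] := HV _ k2.
  rewrite tU// -(rmorphXn (real_complex R)).
  apply: (tau_mean_powers_sub Htau n (ltnW k2) fV).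
  - by move=> j; exact: star_algebra_gen_subalgebra.
  - by move=> j; apply: sub_star_algebra_gen; exists t.
  - by move=> j; apply: (same_star_distribution_isometry Htau (VU j) t0 (UU _ t0)).
  - by move=> j; rewrite (same_star_distribution_tau (VU j) t0) tU.
  - exact: expR_ge0.
  - exact: c1.
have Jcvg n : (fun k : nat => compressed_moment tau (P k) (free_jacobi (P k) U t) n
           : R[i]^o) @ \oo --> ((expR (- t) ^+ n)%:C : R[i]^o).
  by apply: (@cvg_rsqrt_bound _ _ _ (2 * n)%:R) => // k k2; exact: Jbound.
split=> // mu Hmu.
(* The compressed moments converge in [R[i]]; on reals the modulus is the absolute value, so the
   real integrals converge too. *)
have mcvg n : (\int[mu k]_x (x ^+ n)) @[k --> \oo] --> expR (- t) ^+ n.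
  apply/cvgrPdist_le => e e0.
  have e0' : 0 < e%:C by rewrite ltcE /= eqxx.
  have /cvgrPdist_le/(_ _ e0') := Jcvg n.
  apply: filterS2 (nbhs_infty_ge 2) => k k2.
  have [_ ->] := Hmu _ k2.
  by rewrite -rmorphB /= normc_def /= expr0n addr0 sqrtr_sqr lecR.
apply: weakly_converges_dirac.
- by move=> k /Hmu[].
- by have := mcvg 1%N; rewrite expr1; under eq_fun do under eq_Rintegral do rewrite expr1.
- exact: mcvg.
Qed.
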